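(* Assume that $f_1,\ldots,f_r$ have only simple zeros or poles at $s_0$ (i.e. $\ell_j\in\{-1,0,1\}$ for all $j$), that Artin's conjecture does not hold at $s_0$, and that the characters are ordered so that, for integers $1\le p<q\le r$, one has $\ell_1,\ldots,\ell_p>0$, $\ell_{p+1},\ldots,\ell_q<0$, $\ell_{q+1}=\cdots=\ell_r=0$. Then $$\mathbb F[\overline{H(s_0)}]=\mathbb F[x_1,\ldots,x_p,\,x_{q+1}^{\pm1},\ldots,x_r^{\pm1},\,(x_jx_k)^{\pm1}\;:\;1\le j\le p,\ p+1\le k\le q].$$
   Context: Let $K/\mathbb Q$ be a finite Galois extension with Galois group $G$, let $\chi_1,\ldots,\chi_r$ be the irreducible complex characters of $G$, and let $f_j(s)=L(s,\chi_j,K/\mathbb Q)$, $1\le j\le r$, be their Artin L-functions (meromorphic on $\mathbb C$). Fix $s_0\in\mathbb C\setminus\{1\}$ and let $\ell_j:=\operatorname{ord}_{s=s_0}f_j\in\mathbb Z$ be the order of $s_0$ as a zero of $f_j$ (negative if $f_j$ has a pole at $s_0$). Artin's conjecture at $s_0$ is the statement that $f_1,\ldots,f_r$ are all holomorphic at $s_0$; if it fails, some $\ell_j$ is negative and some $\ell_j$ is positive (because the Dedekind zeta function $\zeta_K=\prod_j f_j^{\chi_j(1)}$ is holomorphic at $s_0$), so an ordering as in the claim exists. Let $\mathbb F$ be a field with $\mathbb C\subseteq\mathbb F\subseteq\mathcal M_{<1}$, where $\mathcal M_{<1}$ is the field of meromorphic functions on $\mathbb C$ of order $<1$. For a virtual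 character $\chi=a_1\chi_1+\cdots+a_r\chi_r$, $a_j\in\mathbb Z$, put $L(s,\chi):=f_1^{a_1}\cdots f_r^{a_r}$. Let $\overline{H(s_0)}:=\{a\in\mathbb Z^r: a_1\ell_1+\cdots+a_r\ell_r\ge0\}$, i.e. the set of $a\in\mathbb Z^r$ for which $f_1^{a_1}\cdots f_r^{a_r}$ is holomorphic at $s_0$, and let $\mathbb F[\overline{H(s_0)}]\subseteq\mathbb F[x_1^{\pm1},\ldots,x_r^{\pm1}]$ be the $\mathbb F$-subalgebra of the Laurent polynomial ring spanned by the Laurent monomials $x_1^{a_1}\cdots x_r^{a_r}$ with $a\in\overline{H(s_0)}$. *)

(* Defs.v *)
From HB Require Import structures.
From mathcomp Require Import all_boot all_order all_algebra all_fingroup.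
From mathcomp Require Import all_field all_character.
From mathcomp Require Import complex.
From mathcomp Require Import all_classical all_reals all_analysis.
From mathcomp Require Import finmap.
(* The notations of monalg clash with those of MathComp-Analysis. *)
From mathcomp Require Import -(notations) monalg.

Set Implicit Arguments.
Unset Strict Implicit.
Unset Printing Implicit Defensive.

Import Order.TTheory GRing.Theory Num.Theory.
Import numFieldNormedType.Exports.

Local Open Scope ring_scope.
Local Open Scope complex_scope.
Local Open Scope classical_set_scope.

(* The usual topology on the complex numbers R[i], as a normed space over
   itself: [derivable] at R[i] is then complex differentiability. *)
#[warnings="-all"]
HB.instance Definition _ (R : realType) :=
  NormedModule.copy R[i] (R[i] : numClosedFieldType)^o.

Section Meromorphic.
Context {R : realType}.
Implicit Types (f g : R[i] -> R[i]) (z w : R[i]).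

(* Meromorphic functions are represented by total functions whose values on a
   closed discrete set are irrelevant; [mero_eq] is equality of such. *)
Definition mero_eq f g := forall z, \forall w \near z^', f w = g w.

Definition holomorphic_at f z := \forall w \near z, derivable f w 1.

(* f is holomorphic at z, possibly after removal of a singularity at z. *)
Definition regular_at f z := exists g,
  holomorphic_at g z /\ \forall w \near z^', f w = g w.

Definition meromorphic_at f z := exists n : nat,
  regular_at (fun w => (w - z) ^+ n * f w) z.

Definition meromorphic f := forall z, meromorphic_at f z.

Definition has_ord f z (n : int) := exists g,
  [/\ holomorphic_at g z, g z != 0 &
      \forall w \near z^', f w = (w - z) ^ n * g w].

(* By convention 0 if f vanishes identically around z. *)
Definition ord f z : int := xget 0 [set n | has_ord f z n].

(* Nevanlinna theory.  In MathComp-Analysis ln x = 0 for x <= 0. *)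
Definition logp (x : R) : R := Num.max 0 (ln x).

Definition modulus z : R := complex.Re `|z|.

Definition proximity f (r : R) : R :=
  (2 * pi)^-1 * \int[lebesgue_measure]_(t in `[0, 2 * pi])
                  logp (modulus (f (r%:C * (cos t +i* sin t)))).

Definition pole_mult f z : R := (Num.max 0 (- ord f z))%:~R.

Definition pole_count f (r : R) : R :=
  \sum_(z \in [set z | modulus z <= r]) pole_mult f z.

Definition pole_integrated_count f (r : R) : R :=
  \int[lebesgue_measure]_(t in `]0, r])
     ((pole_count f t - pole_mult f 0) / t) + pole_mult f 0 * ln r.

Definition nevanlinna_char f (r : R) : R :=
  proximity f r + pole_integrated_count f r.

Definition growth_order f : \bar R :=
  limf_esup (fun r : R => (logp (nevanlinna_char f r) / ln r)%:E)
            (pinfty_nbhs R).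

Definition meromorphic_order_lt1 f :=
  meromorphic f /\ (growth_order f < 1)%E.

(* F, through ev, is a field with C <= F <= M_{<1}: the elements of F are
   meromorphic functions of order < 1, and the operations of F are those of
   meromorphic functions.  (Injectivity and the constants give ev 1 = 1.) *)
Definition subfield_of_order_lt1 (F : fieldType) (ev : F -> R[i] -> R[i]) :=
  [/\ forall a, meromorphic_order_lt1 (ev a),
      forall a b, mero_eq (ev a) (ev b) -> a = b,
      forall a b, mero_eq (ev (a + b)) (fun w => ev a w + ev b w),
      forall a b, mero_eq (ev (a * b)) (fun w => ev a w * ev b w) &
      forall c : R[i], exists a, mero_eq (ev a) (fun=> c)].

End Meromorphic.

Section ArtinLFunctions.
Context {R : realType} {K : splittingFieldType rat}.

Local Notation G := 'Gal({:K} / 1)%G.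

Definition algebraic_integer (x : K) := integralOver (intr : int -> K) x.

(* P is a prime ideal of the ring of integers of K with P \cap Z = pZ, for p
   a prime number. *)
Definition prime_ideal_above (p : nat) (P : set K) :=
  [/\ P `<=` algebraic_integer,
      forall x y, P x -> P y -> P (x + y),
      forall x y, algebraic_integer x -> P y -> P (x * y),
      forall x y, algebraic_integer x -> algebraic_integer y ->
        P (x * y) -> P x \/ P y &
      ~ P 1 /\ P p%:R].

Definition inertia_group (P : set K) : {set gal_of {:K}} :=
  [set g in G | `[< forall x, algebraic_integer x -> P (g x - x) >]].

(* An arithmetic Frobenius element; such a g stabilises P. *)
Definition frobenius (p : nat) (P : set K) (g : gal_of {:K}) :=
  g \in G /\ forall x, algebraic_integer x -> P (g x - x ^+ p).

Definition character_of n (rho : mx_representation R[i] G n) :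
  gal_of {:K} -> R[i] := fun g => \tr (rho g).

Definition irr_characters : set (gal_of {:K} -> R[i]) :=
  [set chi | exists n (rho : mx_representation R[i] G n),
     mx_irreducible rho /\ chi = character_of rho].

(* p ^ (- s) *)
Definition nat_cpowN (p : nat) (s : R[i]) : R[i] :=
  (p%:R `^ (- complex.Re s))%:C *
  (cos (complex.Im s * ln p%:R) -i* sin (complex.Im s * ln p%:R)).

(* det (1 - t rho(g) | V^I)^-1, for I the inertia group of P; g acts on the
   basis [row_base] of V^I through the matrix [conjmx]. *)
Definition euler_factor n (rho : mx_representation R[i] G n)
    (P : set K) (g : gal_of {:K}) (t : R[i]) : R[i] :=
  (\det (1%:M - t *: conjmx (row_base (rfix_mx rho (inertia_group P))) (rho g)))^-1.

(* f is the meromorphic continuation to C of the Euler product of chi, which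
   converges for Re s > 1 and depends neither on rho nor on the P p, g p. *)
Definition artin_L_function (chi : gal_of {:K} -> R[i]) (f : R[i] -> R[i]) :=
  meromorphic f /\
  exists n (rho : mx_representation R[i] G n)
         (P : nat -> set K) (g : nat -> gal_of {:K}),
    [/\ chi = character_of rho,
        forall p, prime p -> prime_ideal_above p (P p) /\ frobenius p (P p) (g p) &
        forall s : R[i], 1 < complex.Re s ->
          (fun N => \prod_(0 <= p < N | prime p)
                      euler_factor rho (P p) (g p) (nat_cpowN p s))
            @ \oo --> f s].

End ArtinLFunctions.

Arguments irr_characters R K : clear implicits.

(* The Laurent polynomial ring F[x_1^{+-1}, ..., x_r^{+-1}], as the group
   algebra of Z^r over F. *)
Definition laurent (F : fieldType) (r : nat) : Type :=
  malg {ffun 'I_r -> int} F.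

Section LaurentRing.
Variables (F : fieldType) (r : nat).
Local Notation M := {ffun 'I_r -> int}.
Local Notation L := (laurent F r).

HB.instance Definition _ := GRing.Lmodule.copy L (malg M F).

Implicit Types (u v : L) (a b : M).

(* c x^a *)
Definition laurent_term (c : F) a : L := mkmalgU a c.

Definition laurent_one : L := laurent_term 1 0.

Definition laurent_mul u v : L :=
  \sum_(a <- msupp u) \sum_(b <- msupp v)
     laurent_term (mcoeff a u * mcoeff b v) (a + b).

Lemma laurent_mulw (d1 d2 : {fset M}) u v :
  (msupp u `<=` d1)%fset -> (msupp v `<=` d2)%fset ->
  laurent_mul u v = \sum_(a <- d1) \sum_(b <- d2)
     laurent_term (mcoeff a u * mcoeff b v) (a + b).
Proof.
move=> le_d1 le_d2; rewrite /laurent_mul (big_fset_incl _ le_d1) /=.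
  apply/eq_bigr=> a _; apply/big_fset_incl => // b _ /mcoeff_outdom ->.
  by rewrite mulr0 /laurent_term monalgU0.
move=> a _ /mcoeff_outdom ua.
by rewrite big1 // => b _; rewrite ua mul0r /laurent_term monalgU0.
Qed.

Lemma laurent_mulUU c1 c2 a b :
  laurent_mul (laurent_term c1 a) (laurent_term c2 b) =
  laurent_term (c1 * c2) (a + b).
Proof.
by rewrite (laurent_mulw msuppU_le msuppU_le) !big_seq_fset1 !mcoeffUU.
Qed.

Lemma laurent_mulC : commutative laurent_mul.
Proof.
move=> u v; rewrite /laurent_mul exchange_big /=.
by apply/eq_bigr=> b _; apply/eq_bigr=> a _; rewrite mulrC addrC.
Qed.

Lemma laurent_mulDl : left_distributive laurent_mul +%R.
Proof.
move=> u1 u2 v; have sv := fsubset_refl (msupp v).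
rewrite (laurent_mulw (msuppD_le u1 u2) sv).
rewrite (laurent_mulw (fsubsetUl _ (msupp u2)) sv).
rewrite (laurent_mulw (fsubsetUr (msupp u1) _) sv).
rewrite -big_split /=; apply/eq_bigr=> a _.
rewrite -big_split /=; apply/eq_bigr=> b _.
by rewrite mcoeffD mulrDl /laurent_term monalgUD.
Qed.

Lemma laurent_mulDr : right_distributive laurent_mul +%R.
Proof.
by move=> u v w; rewrite laurent_mulC laurent_mulDl !(laurent_mulC _ u).
Qed.

Lemma laurent_mul0l : left_zero 0 laurent_mul.
Proof. by move=> u; rewrite /laurent_mul msupp0 big_seq_fset0. Qed.

Lemma laurent_mul0r : right_zero 0 laurent_mul.
Proof. by move=> u; rewrite laurent_mulC laurent_mul0l. Qed.

Lemma laurent_termE u :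
  u = \sum_(a <- msupp u) laurent_term (mcoeff a u) a.
Proof. exact: monalgE. Qed.

Lemma laurent_mul_suml (I : Type) (s : seq I) (E : I -> L) v :
  laurent_mul (\sum_(i <- s) E i) v = \sum_(i <- s) laurent_mul (E i) v.
Proof.
exact: (big_morph (laurent_mul^~ v) (fun x y => laurent_mulDl x y v)
          (laurent_mul0l v)).
Qed.

Lemma laurent_mul_sumr (I : Type) (s : seq I) (E : I -> L) u :
  laurent_mul u (\sum_(i <- s) E i) = \sum_(i <- s) laurent_mul u (E i).
Proof.
exact: (big_morph (laurent_mul u) (laurent_mulDr u) (laurent_mul0r u)).
Qed.

Lemma laurent_mulA : associative laurent_mul.
Proof.
move=> u v w.
rewrite (laurent_termE u) (laurent_termE v) (laurent_termE w).
rewrite !laurent_mul_suml; apply: eq_bigr => a _.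
rewrite 2!(laurent_mul_sumr _ _ (laurent_term (mcoeff a u) a)).
rewrite laurent_mul_suml; apply: eq_bigr => b _.
rewrite !laurent_mul_sumr; apply: eq_bigr => c _.
by rewrite !laurent_mulUU mulrA addrA.
Qed.

Lemma laurent_mul1 : left_id laurent_one laurent_mul.
Proof.
move=> u; rewrite [in LHS](laurent_termE u) laurent_mul_sumr.
rewrite [RHS]laurent_termE; apply: eq_bigr => a _.
by rewrite laurent_mulUU mul1r add0r.
Qed.

Lemma laurent_one_neq0 : laurent_one != 0.
Proof. by rewrite /laurent_one /laurent_term monalgU_eq0 oner_eq0. Qed.

HB.instance Definition _ := GRing.Zmodule_isComNzRing.Build L
  laurent_mulA laurent_mulC laurent_mul1 laurent_mulDl laurent_one_neq0.

Lemma laurent_scaleE (c : F) u : c *: u = laurent_mul (laurent_term c 0) u.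
Proof.
rewrite (laurent_mulw msuppU_le (fsubset_refl (msupp u))) big_seq_fset1.
rewrite [in LHS](laurent_termE u) scaler_sumr; apply: eq_bigr => a _.
rewrite mcoeffUU add0r; apply/malgP => b.
by rewrite mcoeffZ !mcoeffU mulrnAr.
Qed.

Lemma laurent_scaleAl (c : F) u v : c *: (u * v) = (c *: u) * v.
Proof. by rewrite !laurent_scaleE; apply: laurent_mulA. Qed.

HB.instance Definition _ := GRing.Lmodule_isLalgebra.Build F L laurent_scaleAl.
HB.instance Definition _ := GRing.Lalgebra_isComAlgebra.Build F L.

(* x^a *)
Definition laurent_monom a : L := laurent_term 1 a.

Lemma laurent_monom0 : laurent_monom 0 = 1.
Proof. by []. Qed.

Lemma laurent_monomD a b :
  laurent_monom (a + b) = laurent_monom a * laurent_monom b.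
Proof. by rewrite -[RHS]/(laurent_mul _ _) laurent_mulUU mulr1. Qed.

(* F[S], for S a submonoid of Z^r: the F-span of the x^a with a in S. *)
Definition semigroup_algebra (S : set M) : set L :=
  [set u | exists (s : seq M) (c : M -> F),
     (forall a, a \in s -> S a) /\
     u = \sum_(a <- s) c a *: laurent_monom a].

Definition generated_subalgebra (X : set L) : set L :=
  smallest (fun B : set L => GRing.subalg_closed [in B]) X.

(* The exponent of the variable x_j. *)
Definition expo (j : 'I_r) : M := [ffun i => (i == j)%:Z].

End LaurentRing.

Arguments laurent_monom {F r} a.
Arguments semigroup_algebra F {r} S.

Definition closed_halfspace (r : nat) (ell : 'I_r -> int) :
  set {ffun 'I_r -> int} := [set a | 0 <= \sum_j a j * ell j].

(* With indices from 0: x_j for j < p, x_k^{+-1} for q <= k, and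
   (x_j x_k)^{+-1} for j < p <= k < q. *)
Definition halfspace_generators (F : fieldType) (r p q : nat) :
  set (laurent F r) :=
  [set u | [\/ exists2 j : 'I_r, (j < p)%N & u = laurent_monom (expo j),
     exists2 k : 'I_r, (q <= k)%N &
       u = laurent_monom (expo k) \/ u = laurent_monom (- expo k) |
     exists j k : 'I_r, [/\ (j < p)%N, (p <= k < q)%N &
       u = laurent_monom (expo j + expo k) \/
       u = laurent_monom (- (expo j + expo k))]]].

Arguments halfspace_generators F r p q : clear implicits.

(* Main.v *)
Require Import Defs.
From mathcomp Require Import all_boot all_order all_algebra all_fingroup.
From mathcomp Require Import all_field all_character.
From mathcomp Require Import complex.
From mathcomp Require Import all_classical all_reals all_analysis.
From mathcomp Require Import finmap.
From mathcomp Require Import -(notations) monalg.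

(** Write l_j for the order of f_j at s0; no property of the f_j is used beyond
    the values of these integers.  The left-hand side consists of the Laurent
    polynomials all of whose exponents a satisfy l(a) := sum_j a_j l_j >= 0.
    As these exponents form a submonoid of Z^r, it is a subalgebra, and it
    contains the generators of the right-hand side because their exponents have
    l equal to 1 or 0.

    Conversely, let B be a subalgebra containing the generators.  The exponents
    a with x^a in B form a submonoid T of Z^r.  Fix an index j0 with l_j0 = 1;
    then every a in Z^r decomposes as
      a = l(a) e_j0 + sum_i a_i (e_i - l_i e_j0).
    If l(a) >= 0 the first term is in T, since x_j0 is a generator.  It remains
    to see that T contains both w_i := e_i - l_i e_j0 and - w_i.  If l_i is 0
    or -1 this is because w_i is e_i or e_j0 + e_i, the exponent of an
    invertible generator.  If l_i = 1, choose k0 with l_k0 = -1: then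
    w_i = (e_i + e_k0) - (e_j0 + e_k0) is a difference of two such exponents. *)

Import Order.TTheory GRing.Theory Num.Theory.

Local Open Scope ring_scope.
Local Open Scope complex_scope.
Local Open Scope classical_set_scope.

Section SemigroupAlgebra.
Context {F : fieldType} {r : nat}.
Local Notation M := {ffun 'I_r -> int}.
Local Notation L := (laurent F r).

Lemma mcoeff_laurent_monom (a b : M) :
  mcoeff b (laurent_monom a : L) = (a == b)%:R.
Proof. by rewrite /laurent_monom /laurent_term mcoeffU. Qed.

Lemma subalg_closedP (B : set L) :
  GRing.subalg_closed [in B] <->
  [/\ B 1, forall (c : F) u v, B u -> B v -> B (c *: u + v) &
      forall u v, B u -> B v -> B (u * v)].
Proof.
split=> -[B1 Blin BM]; split.
- exact: set_mem B1.
- by move=> c u v /mem_set Bu /mem_set Bv; apply: set_mem (Blin c u v Bu Bv).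
- by move=> u v /mem_set Bu /mem_set Bv; apply: set_mem (BM u v Bu Bv).
- exact: mem_set B1.
- by move=> c u v /set_mem Bu /set_mem Bv; apply: mem_set (Blin c u v Bu Bv).
- by move=> u v /set_mem Bu /set_mem Bv; apply: mem_set (BM u v Bu Bv).
Qed.

(** Membership read off the support: a representation as a finite sum may
    repeat exponents, whereas this criterion does not depend on one. *)
Lemma semigroup_algebraP (S : set M) (u : L) :
  semigroup_algebra F S u <-> forall a, mcoeff a u != 0 -> S a.
Proof.
split=> [[s [c [sS ->]]] a|uS].
  have [/sS //|a_s] := boolP (a \in s).
  rewrite raddf_sum big_seq big1 ?eqxx // => b b_s /=.
  rewrite mcoeffZ mcoeff_laurent_monom; case: eqP => [ba|_]; last exact: mulr0.
  by rewrite -ba b_s in a_s.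
exists (enum_fset (msupp u)), (fun a => mcoeff a u); split=> [a|].
  by move=> a_u; apply: uS; rewrite mcoeff_neq0.
rewrite [LHS]laurent_termE; apply: eq_bigr => a _.
by rewrite /laurent_monom laurent_scaleE laurent_mulUU mulr1 add0r.
Qed.

Lemma semigroup_algebra_monom {S : set M} {a : M} :
  S a -> semigroup_algebra F S (laurent_monom a).
Proof.
move=> Sa; apply/semigroup_algebraP => b; rewrite mcoeff_laurent_monom.
by case: (eqVneq a b) => [<-|]; rewrite ?eqxx.
Qed.

Lemma semigroup_algebra_linear {S : set M} (c : F) {u v : L} :
  semigroup_algebra F S u -> semigroup_algebra F S v ->
  semigroup_algebra F S (c *: u + v).
Proof.
move=> /semigroup_algebraP uS /semigroup_algebraP vS.
apply/semigroup_algebraP => a; rewrite mcoeffD mcoeffZ.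
have [ua|/uS //] := eqVneq (mcoeff a u) 0.
by rewrite ua mulr0 add0r => /vS.
Qed.

Lemma semigroup_algebra_sum {S : set M} (I : eqType) (s : seq I) (E : I -> L) :
  (forall i, i \in s -> semigroup_algebra F S (E i)) ->
  semigroup_algebra F S (\sum_(i <- s) E i).
Proof.
move=> ES; rewrite big_seq; apply: big_ind => // [|u v Su Sv].
  by apply/semigroup_algebraP => a; rewrite mcoeff0 eqxx.
by rewrite -[u]scale1r; apply: semigroup_algebra_linear.
Qed.

Lemma semigroup_algebra_subalg (S : set M) :
  S 0 -> (forall a b, S a -> S b -> S (a + b)) ->
  GRing.subalg_closed [in semigroup_algebra F S].
Proof.
move=> S0 SD; apply/subalg_closedP; split=> [|c u v|u v].
- by rewrite -laurent_monom0; apply: semigroup_algebra_monom.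
- exact: semigroup_algebra_linear.
move=> /semigroup_algebraP uS /semigroup_algebraP vS.
rewrite -[u * v]/(laurent_mul u v) /laurent_mul.
apply: semigroup_algebra_sum => a; rewrite -mcoeff_neq0 => /uS Sa.
apply: semigroup_algebra_sum => b; rewrite -mcoeff_neq0 => /vS Sb.
apply/semigroup_algebraP => d; rewrite /laurent_term mcoeffU.
by case: (eqVneq (a + b) d) => [<- _|]; [apply: SD | rewrite mulr0n eqxx].
Qed.

(** A subalgebra containing the monomials with exponents in S contains their
    span. *)
Lemma semigroup_algebra_sub (S : set M) (B : set L) :
  GRing.subalg_closed [in B] -> (forall a, S a -> B (laurent_monom a)) ->
  semigroup_algebra F S `<=` B.
Proof.
move=> /subalg_closedP[B1 Blin _] SB u [s [c [sS ->]]].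
have B0 : B 0 by have := Blin (-1) 1 1 B1 B1; rewrite scaleN1r addNr.
rewrite big_seq; elim/big_rec: _ => [//|a v /sS/SB Ba Bv].
exact: Blin.
Qed.

End SemigroupAlgebra.

Section Halfspace.
Context {r : nat}.
Local Notation M := {ffun 'I_r -> int}.
Implicit Types (a b : M) (ell : 'I_r -> int).

Lemma closed_halfspaceD ell a b :
  closed_halfspace ell a -> closed_halfspace ell b ->
  closed_halfspace ell (a + b).
Proof.
rewrite /closed_halfspace /= => ha hb.
under eq_bigr do rewrite ffunE mulrDl.
by rewrite big_split addr_ge0.
Qed.

Lemma closed_halfspace0 ell : closed_halfspace ell 0.
Proof. by rewrite /closed_halfspace /= big1 // => i _; rewrite ffunE mul0r. Qed.

(** The linear form defined by ell maps the exponent of x_j to ell j. *)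
Lemma sum_expo ell (j : 'I_r) : \sum_i expo j i * ell i = ell j.
Proof.
rewrite (bigD1 j) //= ffunE eqxx mul1r big1 ?addr0 // => i /negPf ij.
by rewrite ffunE ij mul0r.
Qed.

Lemma ffunMzE a (n : int) (i : 'I_r) : (a *~ n) i = a i *~ n.
Proof.
case: n => n; first exact: ffunMnE.
by rewrite NegzE !mulrNz ffunE; congr (- _); apply: ffunMnE.
Qed.

Lemma ffun_sum_expo a : a = \sum_i expo i *~ a i.
Proof.
apply/ffunP => j; rewrite sum_ffunE (bigD1 j) //= big1 => [|i /negPf ij].
  by rewrite ffunMzE ffunE eqxx intz addr0.
by rewrite ffunMzE ffunE eq_sym ij mul0rz.
Qed.

(** The decomposition a = ell(a) e_j + sum_i a_i (e_i - ell_i e_j), as a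
    criterion for a submonoid of Z^r to contain a closed half-space. *)
Lemma closed_halfspace_sub ell (j : 'I_r) (T : set M) :
  T 0 -> (forall a b, T a -> T b -> T (a + b)) -> T (expo j) ->
  (forall i, T (expo i - expo j *~ ell i) /\ T (- (expo i - expo j *~ ell i))) ->
  closed_halfspace ell `<=` T.
Proof.
move=> T0 TD Tj Tw a; rewrite /closed_halfspace /= => a_ge0.
have TMn b n : T b -> T (b *+ n).
  by move=> Tb; elim: n => [//|n IHn]; rewrite mulrS; apply: TD.
have -> : a = expo j *~ (\sum_i a i * ell i) +
              \sum_i (expo i - expo j *~ ell i) *~ a i.
  under [X in _ + X]eq_bigr do rewrite mulrzBl -mulrzA mulrC.
  rewrite sumrB -ffun_sum_expo -mulrz_sumr.
  by rewrite [RHS]addrC subrK.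
apply: (TD); first by case: (\sum_i _) a_ge0 => // n _; apply: TMn.
apply: big_ind => // i _; have [Twi TNwi] := Tw i.
by case: (a i) => n; [apply: TMn | rewrite NegzE mulrNz -mulNrz; apply: TMn].
Qed.

End Halfspace.

Theorem proposition2p3
  (R : realType) (K : splittingFieldType rat) (galK : galois 1 {:K})
  (r : nat) (chi : 'I_r -> gal_of {:K} -> R[i])
  (chi_irr : set_bij [set: 'I_r] (irr_characters R K) chi)
  (f : 'I_r -> R[i] -> R[i])
  (f_artin : forall j, artin_L_function (chi j) (f j))
  (s0 : R[i]) (s0_neq1 : s0 <> 1)
  (F : fieldType) (ev : F -> R[i] -> R[i])
  (F_sub : subfield_of_order_lt1 ev)
  (f_simple : forall j, ord (f j) s0 \in [:: -1; 0; 1])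
  (not_artin : ~ (forall j, regular_at (f j) s0))
  (p q : nat) (p_ge1 : (1 <= p)%N) (p_lt_q : (p < q)%N) (q_le_r : (q <= r)%N)
  (ord_pos : forall j : 'I_r, (j < p)%N -> 0 < ord (f j) s0)
  (ord_neg : forall j : 'I_r, (p <= j < q)%N -> ord (f j) s0 < 0)
  (ord_zero : forall j : 'I_r, (q <= j)%N -> ord (f j) s0 = 0) :
  semigroup_algebra F (closed_halfspace (fun j => ord (f j) s0)) =
  generated_subalgebra (halfspace_generators F r p q).
Proof.
pose ell j := ord (f j) s0.
have ell_pos (j : 'I_r) : (j < p)%N -> ell j = 1.
  move=> jp; have := ord_pos j jp; have := f_simple j; rewrite -/(ell j) !inE.
  by case/or3P => /eqP ->.
have ell_neg (j : 'I_r) : (p <= j < q)%N -> ell j = -1.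
  move=> jpq; have := ord_neg j jpq; have := f_simple j; rewrite -/(ell j) !inE.
  by case/or3P => /eqP ->.
pose H : set {ffun 'I_r -> int} := closed_halfspace ell.
have H0 : H 0 := closed_halfspace0 ell.
have HD a b : H a -> H b -> H (a + b) by apply: closed_halfspaceD.
have H_expo (j : 'I_r) : 0 <= ell j -> H (expo j).
  by rewrite /H /closed_halfspace /= sum_expo.
(* H contains the kernel of the linear form, which is a group. *)
have H_opp (a : {ffun 'I_r -> int}) : \sum_i a i * ell i = 0 -> H a /\ H (- a).
  rewrite /H /closed_halfspace /= => a0; split; first by rewrite a0.
  by under eq_bigr do rewrite ffunE mulNr; rewrite sumrN a0 oppr0.
rewrite -/H; apply/seteqP; split=> [u Hu B [B_subalg XB]|]; last first.
  apply: smallest_sub; first exact: semigroup_algebra_subalg.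
  move=> u [[j jp ->]|[k qk]|[j [k [jp kpq]]]].
  - by apply: semigroup_algebra_monom; apply: H_expo; rewrite ell_pos.
  - have [Hk HNk] : H (expo k) /\ H (- expo k).
      by apply: H_opp; rewrite sum_expo; apply: ord_zero.
    by case=> ->; apply: semigroup_algebra_monom.
  - have [Hjk HNjk] : H (expo j + expo k) /\ H (- (expo j + expo k)).
      apply: H_opp; under eq_bigr do rewrite ffunE mulrDl.
      by rewrite big_split /= !sum_expo ell_pos // ell_neg.
    by case=> ->; apply: semigroup_algebra_monom.
apply: (semigroup_algebra_sub H B B_subalg _ u Hu) => {u Hu}.
have [B1 _ BM] := (subalg_closedP B).1 B_subalg.
pose j0 : 'I_r := Ordinal (leq_trans p_ge1 (leq_trans (ltnW p_lt_q) q_le_r)).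
pose k0 : 'I_r := Ordinal (leq_trans p_lt_q q_le_r).
have k0pq : (p <= k0 < q)%N by rewrite leqnn.
pose T : set {ffun 'I_r -> int} := [set a | B (laurent_monom a)].
have TD a b : T a -> T b -> T (a + b).
  by rewrite /T /= laurent_monomD; apply: BM.
have Tjk (j k : 'I_r) : (j < p)%N -> (p <= k < q)%N ->
    T (expo j + expo k) /\ T (- (expo j + expo k)).
  by move=> jp kpq; split; apply: XB; apply: Or33; exists j, k;
    split=> //; [left | right].
apply: (closed_halfspace_sub ell j0 T) => //.
- by apply: XB; apply: Or31; exists j0.
move=> i; case: (ltnP i p) => [ip|pi].
  rewrite ell_pos // mulr1z.
  have [Ti TNi] := Tjk i k0 ip k0pq; have [Tj TNj] := Tjk j0 k0 p_ge1 k0pq.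
  have -> : expo i - expo j0 = (expo i + expo k0) - (expo j0 + expo k0).
    by rewrite opprD addrACA subrr addr0.
  by split; [apply: TD | rewrite opprB; apply: TD].
case: (ltnP i q) => [iq|qi].
  have ipq : (p <= i < q)%N by rewrite pi.
  by rewrite ell_neg // mulrN1z opprK addrC; apply: Tjk.
rewrite (ord_zero i qi : ell i = 0) mulr0z subr0.
by split; apply: XB; apply: Or32; exists i => //; [left | right].
Qed.
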